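(* Let $n\ge 3$ and let $\mathbf u,\mathbf v$ be ai-semiring terms. Then $M_n(S_7)\models \mathbf u\approx\mathbf v$ if and only if the following four equalities hold: $$c(\mathbf u_{11}^{(3)})=c(\mathbf v_{11}^{(3)}),\quad \delta(\mathbf u_{11}^{(3)})=\delta(\mathbf v_{11}^{(3)}),\quad c(\mathbf u_{12}^{(3)})=c(\mathbf v_{12}^{(3)}),\quad \delta(\mathbf u_{12}^{(3)})=\delta(\mathbf v_{12}^{(3)}).$$
   Context: An additively idempotent semiring (ai-semiring) is an algebra $(S,+,\cdot)$ with $(S,+)$ a commutative idempotent semigroup, $(S,\cdot)$ a semigroup, and multiplication distributing over addition on both sides. An ai-semiring term is identified with a finite nonempty set of nonempty words over the variables, written as a formal sum $\mathbf u=u_1+\cdots+u_r$ (repeated summands are immaterial). $S_7=\{1,a,\infty\}$ is the ai-semiring with addition $x+x=x$ and $x+y=\infty$ for $x\ne y$, and with commutative multiplication $1\cdot 1=1$, $1\cdot a=a\cdot 1=a$, $a\cdot a=\infty$, $x\cdot\infty=\infty\cdot x=\infty$. $M_n(S_7)$ is the ai-semiring of all $n\times n$ matrices over $S_7$ with entrywise addition and usual matrix multiplication. For a term or word $\mathbf u$, $c(\mathbf u)$ is the set of variables occurring in $\mathbf u$; $\mathrm{occ}(x,w)$ is the number of occurrences of the variable $x$ in the word $w$. $\delta(\mathbf u)$ is the set of all nonempty subsets $Z\subseteq c(\mathbf u)$ such that for every word $w$ occurring as a summand of $\mathbf u$ there is a variable $x$ with $Z\cap c(w)=\{x\}$ and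 $\mathrm{occ}(x,w)=1$. Coordinate expansions: for each variable $x$ and each $r,s\in[n]=\{1,\dots,n\}$ introduce a new variable $x_{rs}$. For a word $w=x_1\cdots x_m$ and $p,q\in[n]$, put $$w_{pq}^{(n)}=\sum_{i_1,\dots,i_{m-1}\in[n]} x_{1,p i_1}\,x_{2,i_1i_2}\cdots x_{m,i_{m-1}q},$$ where $x_{t,rs}$ denotes the new variable attached to the letter $x_t$ and the indices $r,s$; for $m=1$ this means $w_{pq}^{(n)}=x_{1,pq}$. For a term $\mathbf u=u_1+\cdots+u_r$, put $\mathbf u_{pq}^{(n)}=(u_1)_{pq}^{(n)}+\cdots+(u_r)_{pq}^{(n)}$, with repetitions deleted. *)

(* Defs.v *)
From HB Require Import structures.
From mathcomp Require Import all_boot all_algebra finmap.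

Set Implicit Arguments.
Unset Strict Implicit.
Unset Printing Implicit Defensive.

Local Open Scope fset_scope.

(* Addition is that of the library's additive semigroups, multiplication that
   of its (noncommutative) semigroups; neither operation has a unit. *)
HB.mixin Record isAiSemiring S of GRing.AddSemigroup S & Semigroup S := {
  aiaddxx : idempotent_op (@GRing.add S);
  aimulDl : left_distributive (@monoid.mul S) (@GRing.add S);
  aimulDr : right_distributive (@monoid.mul S) (@GRing.add S)
}.

#[short(type="aiSemiringType")]
HB.structure Definition AiSemiring :=
  {S of isAiSemiring S & GRing.AddSemigroup S & Semigroup S}.

(* Sums in an ai-semiring are computed in [option S], where [None] plays the
   role of an adjoined zero; a nonempty sum of elements of S is in S. *)
Section OptionSemiring.
Variable S : aiSemiringType.
Implicit Types x y z : option S.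

Definition oadd : option S -> option S -> option S :=
  oAC (@Algebra.addrA S) (@Algebra.addrC S).

HB.instance Definition _ :=
  Monoid.ComLaw.copy oadd (oAC (@Algebra.addrA S) (@Algebra.addrC S)).

Definition omul x y : option S :=
  if x is Some a then (if y is Some b then Some (a * b)%g else None) else None.

Lemma omul0x : left_zero None omul. Proof. by []. Qed.

Lemma omulx0 : right_zero None omul. Proof. by case. Qed.

Lemma omulA : associative omul.
Proof. by case=> [a|] [b|] [c|] //=; rewrite mulgA. Qed.

Lemma omulDl : left_distributive omul oadd.
Proof. by case=> [a|] [b|] [c|] //; rewrite /oadd ?oACE /= ?oACE ?aimulDl. Qed.

Lemma omulDr : right_distributive omul oadd.
Proof. by case=> [a|] [b|] [c|] //; rewrite /oadd ?oACE /= ?oACE ?aimulDr. Qed.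

Lemma oadd_isSomel x y : isSome x -> isSome (oadd x y).
Proof. by case: x y => [a|] [b|]. Qed.

Lemma obig_isSome (I : eqType) (r : seq I) (F : I -> option S) (i : I) :
  i \in r -> isSome (F i) -> isSome (\big[oadd/None]_(j <- r) F j).
Proof.
by move=> ir Fi; rewrite (big_rem i) //=; apply: oadd_isSomel.
Qed.

End OptionSemiring.

Definition aimatrix (S : Type) (n : nat) : Type := 'M[S]_n.

HB.instance Definition _ (S : choiceType) n := Choice.on (aimatrix S n).

Section MatrixAiSemiring.
Variables (S : aiSemiringType) (n : nat).
Implicit Types A B C : aimatrix S n.

Definition aimx_add A B : aimatrix S n := map2_mx (@GRing.add S) A B.

Lemma aimx_mul_subproof A B (i j : 'I_n) :
  isSome (\big[@oadd S/None]_(k < n) Some (A i k * B k j)%g).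
Proof. exact: (@obig_isSome _ _ _ _ i (mem_index_enum i)). Qed.

Definition aimx_mul A B : aimatrix S n :=
  (\matrix_(i, j) oextract (aimx_mul_subproof A B i j))%R.

Lemma Some_aimx_mul A B i j :
  Some (aimx_mul A B i j) = \big[@oadd S/None]_k Some (A i k * B k j)%g.
Proof. by rewrite mxE Some_oextract. Qed.

Lemma aimx_addC : commutative aimx_add.
Proof. by move=> A B; apply/matrixP=> i j; rewrite !mxE Algebra.addrC. Qed.

Lemma aimx_addA : associative aimx_add.
Proof. by move=> A B C; apply/matrixP=> i j; rewrite !mxE Algebra.addrA. Qed.

Lemma aimx_addxx : idempotent_op aimx_add.
Proof. by move=> A; apply/matrixP=> i j; rewrite !mxE aiaddxx. Qed.

Lemma aimx_mulA : associative aimx_mul.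
Proof.
move=> A B C; apply/matrixP=> i j; apply: Some_inj.
rewrite !Some_aimx_mul.
transitivity (\big[@oadd S/None]_k \big[@oadd S/None]_l
  omul (Some (A i k)) (omul (Some (B k l)) (Some (C l j)))).
  apply: eq_bigr => k _.
  rewrite -[Some (_ * _)%g]/(omul (Some (A i k)) (Some (aimx_mul B C k j))).
  rewrite Some_aimx_mul.
  by rewrite (big_morph _ (@omulDr S (Some (A i k))) (omulx0 (Some (A i k)))).
rewrite exchange_big; apply: eq_bigr => l _ /=.
rewrite -[Some (aimx_mul A B i l * _)%g]/(omul (Some (aimx_mul A B i l)) (Some (C l j))).
rewrite Some_aimx_mul.
rewrite (big_morph (fun x => omul x (Some (C l j)))
  (fun x y => @omulDl S x y (Some (C l j))) (omul0x (Some (C l j)))).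
by apply: eq_bigr => k _ /=; rewrite mulgA.
Qed.

Lemma aimx_mulDl : left_distributive aimx_mul aimx_add.
Proof.
move=> A B C; apply/matrixP=> i j; apply: Some_inj.
rewrite [in RHS]mxE -[Some (_ + _)%R]/(oadd (Some _) (Some _)) !Some_aimx_mul -big_split /=.
by apply: eq_bigr => k _; rewrite mxE aimulDl.
Qed.

Lemma aimx_mulDr : right_distributive aimx_mul aimx_add.
Proof.
move=> A B C; apply/matrixP=> i j; apply: Some_inj.
rewrite [in RHS]mxE -[Some (_ + _)%R]/(oadd (Some _) (Some _)) !Some_aimx_mul -big_split /=.
by apply: eq_bigr => k _; rewrite mxE aimulDr.
Qed.

HB.instance Definition _ :=
  GRing.isAddSemigroup.Build (aimatrix S n) aimx_addC aimx_addA.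
HB.instance Definition _ := isSemigroup.Build (aimatrix S n) aimx_mulA.
HB.instance Definition _ :=
  isAiSemiring.Build (aimatrix S n) aimx_addxx aimx_mulDl aimx_mulDr.

End MatrixAiSemiring.

Inductive S7 : Type := S7one | S7a | S7inf.

Definition S7_code (x : S7) : option bool :=
  match x with S7one => Some true | S7a => Some false | S7inf => None end.

Definition S7_decode (c : option bool) : S7 :=
  match c with Some true => S7one | Some false => S7a | None => S7inf end.

Lemma S7_codeK : cancel S7_code S7_decode. Proof. by case. Qed.

HB.instance Definition _ := Finite.copy S7 (can_type S7_codeK).

Definition S7_add (x y : S7) : S7 := if x == y then x else S7inf.

Definition S7_mul (x y : S7) : S7 :=
  match x, y with
  | S7one, S7one => S7one
  | S7one, S7a | S7a, S7one => S7a
  | _, _ => S7inf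
  end.

Lemma S7_addC : commutative S7_add. Proof. by do 2!case. Qed.
Lemma S7_addA : associative S7_add. Proof. by do 3!case. Qed.
Lemma S7_addxx : idempotent_op S7_add. Proof. by case. Qed.
Lemma S7_mulA : associative S7_mul. Proof. by do 3!case. Qed.
Lemma S7_mulDl : left_distributive S7_mul S7_add. Proof. by do 3!case. Qed.
Lemma S7_mulDr : right_distributive S7_mul S7_add. Proof. by do 3!case. Qed.

HB.instance Definition _ := GRing.isAddSemigroup.Build S7 S7_addC S7_addA.
HB.instance Definition _ := isSemigroup.Build S7 S7_mulA.
HB.instance Definition _ := isAiSemiring.Build S7 S7_addxx S7_mulDl S7_mulDr.

Record term (X : choiceType) := Term {
  words :> {fset seq X};
  words_neq0 : words != fset0;
  words_nonnil : [::] \notin words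
}.

Section Eval.
Variables (X : choiceType) (S : aiSemiringType) (phi : X -> S).

Definition eval_word (w : seq X) : option S :=
  if w is x :: w' then Some (foldl (@monoid.mul S) (phi x) (map phi w')) else None.

Lemma eval_subproof (u : term X) :
  isSome (\big[@oadd S/None]_(w <- u) eval_word w).
Proof.
have /fset0Pn[w wu] := words_neq0 u.
by apply: (obig_isSome wu); case: w wu (words_nonnil u) => [->|].
Qed.

Definition eval (u : term X) : S := oextract (eval_subproof u).

End Eval.

Definition satisfies (S : aiSemiringType) (X : choiceType) (u v : term X) :=
  forall phi : X -> S, eval phi u = eval phi v.

Section WordSets.
Variable V : choiceType.
Implicit Types (w : seq V) (u : {fset seq V}).

Definition wcontent w : {fset V} := [fset x in w].

Definition content u : {fset V} := \bigcup_(w <- u) wcontent w.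

Definition delta u : {fset {fset V}} :=
  [fset Z in fpowerset (content u) | (Z != fset0) &&
     all (fun w => has (fun x => (Z `&` wcontent w == [fset x]) &&
                                 (count_mem x w == 1)) w) u].

End WordSets.

Section Coordinates.
Variables (X : choiceType) (n : nat) (p q : 'I_n).

(* The coordinate variable x_{rs} is the pair (x, (r, s)). The word with
   intermediate indices s = i_1 .. i_{m-1} carries on its t-th letter the t-th
   entries of p i_1 .. i_{m-1} and of i_1 .. i_{m-1} q. *)
Definition coord_word (w : seq X) (s : seq 'I_n) : seq (X * ('I_n * 'I_n)) :=
  zip w (zip (p :: s) (rcons s q)).

Definition expand_word (w : seq X) : {fset seq (X * ('I_n * 'I_n))} :=
  [fset coord_word w (tval s) | s : (size w).-1.-tuple 'I_n].

Definition expand (u : {fset seq X}) : {fset seq (X * ('I_n * 'I_n))} :=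
  \bigcup_(w <- u) expand_word w.

End Coordinates.

(* Ordinals count from 0, so these are the indices written 1 and 2 in [3]. *)
Definition idx1 : 'I_3 := @Ordinal 3 0 isT.
Definition idx2 : 'I_3 := @Ordinal 3 1 isT.

(* Main.v *)
Require Import Defs.
From HB Require Import structures.
From mathcomp Require Import all_boot all_algebra finmap.
From mathcomp Require Import zify.

(** Give the elements 1, a, oo of S_7 the weights 0, 1, 2. A product or a sum
    takes a value of weight b <= 1 exactly when, for a product, the weights of
    the factors add up to b and, for a sum, every summand has weight b. Hence
    an S_7-valued term takes the value of weight b exactly when each of its
    words has total weight b ([weighs]); two terms agree under all assignments
    iff these conditions agree for b = 0 and b = 1 ([equiweighted]), which is
    what equality of [content] (case b = 0) and of [delta] (case b = 1, the
    members of delta being the sets of variables sent to a) expresses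
    ([equiweightedP]). In the matrix semiring the (p, q) entry of a term is the
    S_7-term given by its coordinate expansion, so M_n(S_7) satisfies u = v iff
    the expansions of u and v are equiweighted for all p, q in [n]
    ([satisfies_equiweighted]).

    From n to 3: [3] is a retract of [n], and an assignment on [3] pulled back
    along the retraction has the same weights on walks
    ([equiweighted_retract]).

    From 3 to n: let all words of u have weight b on all walks from p to q in
    [n]. Pulling back along maps 1 -> p, 2 -> q, 3 -> k (which need not be
    injective, so that the pair of indices (1, 2) also covers p = q) shows
    that the words of v have weight b on the walks which stay inside
    {p, q, k}, for each k. For the remaining walks a letter x of a word of v is
    needed on edges (r, s) with r and s both outside {p, q}. If x is neither
    first nor last in its word, the coordinate x_33 occurs in the (1, 2)
    expansion of v, hence of u, so x is interior to some word of u; comparing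
    walks through that occurrence gives the exchange law
    A_x(r,s) + A_x(p,p) = A_x(r,p) + A_x(p,s) ([interior_modular]). With this
    law the vertices of a walk can be replaced by p one at a time, each
    replacement being controlled by a walk with at most one vertex k outside
    {p, q} ([weight_walk_base]). *)

Set Implicit Arguments.
Unset Strict Implicit.
Unset Printing Implicit Defensive.

Local Open Scope fset_scope.
Local Open Scope nat_scope.

(** * Weights in S_7 *)

Definition wt (x : S7) : nat :=
  match x with S7one => 0 | S7a => 1 | S7inf => 2 end.

Lemma wt_inj : injective wt. Proof. by do 2!case. Qed.

Lemma wt_le2 x : wt x <= 2. Proof. by case: x. Qed.

(** Weight 2 is recognized as the failure of weights 0 and 1; only for these
    two does the weight of a product or sum depend additively, or summandwise,
    on the weights of the arguments. *)
Lemma wt_inj_le1 x y :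
  (forall b, b <= 1 -> wt x = b <-> wt y = b) -> x = y.
Proof.
move=> H; have [H0 H1] := (H 0 isT, H 1 isT); clear H; apply: wt_inj.
by have := wt_le2 x; have := wt_le2 y; lia.
Qed.

Lemma wt_mul (x y : S7) b : b <= 1 -> wt (x * y)%g = b <-> wt x + wt y = b.
Proof. by case: b => [|[|//]] _; case: x; case: y. Qed.

Lemma wt_add (x y : S7) b :
  b <= 1 -> wt (x + y)%R = b <-> wt x = b /\ wt y = b.
Proof.
by case: b => [|[|//]] _; case: x; case: y; split => //=; (case||move=> ->).
Qed.

(** [F] may take the value [None], as the evaluation of the empty word does;
    such terms are absent from the sum. *)
Lemma wt_osum (I : eqType) (r : seq I) (F : I -> option S7) y b : b <= 1 ->
  \big[@oadd S7/None]_(i <- r) F i = Some y ->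
  wt y = b <-> (forall i z, i \in r -> F i = Some z -> wt z = b).
Proof.
move=> b1; elim: r y => [|i r IHr] y; first by rewrite big_nil.
rewrite big_cons; case Er: (\big[_/_]_(j <- r) F j) => [t|]; last first.
  case Fi: (F i) => [z|] //= [<-]; split=> [zb j z'|]; last first.
    by move/(_ i z); apply; rewrite ?mem_head.
  rewrite inE => /predU1P[->|jr]; first by rewrite Fi => -[<-].
  move=> Fj; suff: isSome (\big[@oadd S7/None]_(j <- r) F j) by rewrite Er.
  by apply: (obig_isSome jr); rewrite Fj.
have {}IHr := IHr _ Er.
case Fi: (F i) => [z|] //= [<-].
  rewrite wt_add // IHr; split=> [[zb H] j z'|H].
    by rewrite inE => /predU1P[->|]; [rewrite Fi => -[<-]|exact: H].
  split=> [|j z' jr]; first by apply: (H i z); rewrite ?mem_head.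
  by apply: H; rewrite inE jr orbT.
rewrite IHr; split=> H j z' jr; last by apply: H; rewrite inE jr orbT.
by move: jr; rewrite inE => /predU1P[->|]; [rewrite Fi|exact: H].
Qed.

(** * Terms over S_7: content and delta *)

Section Weight.
Variable V : choiceType.
Implicit Types (A : V -> S7) (w : seq V) (U : {fset seq V}).

Definition weight A w : nat := \sum_(z <- w) wt (A z).

Definition weighs U A b := forall w, w \in U -> weight A w = b.

(** For S_7-terms this is the identity U = U' in S_7: U takes the value 1 or a
    under A iff it satisfies the condition for b = 0 or b = 1. *)
Definition equiweighted U U' :=
  forall A b, b <= 1 -> weighs U A b <-> weighs U' A b.

Lemma contentP U z :
  reflect (exists2 w, w \in U & z \in w) (z \in content U).
Proof.
rewrite /content.
apply: (iffP (bigfcupP _ _ _ _)) => [[w /andP[wU _]]|[w wU zw]]; last first.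
  by exists w; rewrite ?wU // inE.
by rewrite inE => zw; exists w.
Qed.

(** The two requirements on w in the definition of delta, a single common
    variable and a single occurrence of it, say together that w has exactly one
    position with a letter of Z. *)
Lemma has_unique_occurrence (Z : {fset V}) w :
  has (fun x => (Z `&` wcontent w == [fset x]) && (count_mem x w == 1)) w
  = (count (mem Z) w == 1).
Proof.
apply/hasP/eqP => [[x xw /andP[/eqP Zw /eqP <-]]|].
  apply: eq_in_count => y yw /=.
  by move/fsetP/(_ y): Zw; rewrite !inE yw andbT.
move=> w1; have : has (mem Z) w by rewrite has_count w1.
case/hasP => x xw xZ; exists x => //.
have cle : count_mem x w <= 1.
  by rewrite -w1; apply: sub_count => y /= /eqP ->.
have cge : 0 < count_mem x w by rewrite -has_count has_pred1.
have c1 : count_mem x w = 1 by lia.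
rewrite c1 eqxx andbT; apply/eqP/fsetP => y; rewrite !inE.
apply/andP/eqP => [[yZ yw]|->//]; apply/eqP/negPn/negP => yx.
have : count (predU (pred1 x) (pred1 y)) w <= count (mem Z) w.
  by apply: sub_count => t /= /orP[] /eqP ->.
have : 0 < count_mem y w by rewrite -has_count has_pred1.
have := count_predUI (pred1 x) (pred1 y) w.
rewrite w1 c1 (@eq_count _ (predI _ _) pred0) ?count_pred0 ?addn0; first by lia.
by move=> t /=; apply/andP => -[/eqP -> /eqP xy]; rewrite xy eqxx in yx.
Qed.

Lemma deltaP U Z :
  Z \in delta U <->
  [/\ Z `<=` content U, Z != fset0 & forall w, w \in U -> count (mem Z) w = 1].
Proof.
rewrite /delta !inE /= fpowersetE; split.
  case/and3P=> ZU Z0 /allP H; split=> // w /H.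
  by rewrite has_unique_occurrence => /eqP.
case=> -> -> H; apply/allP => w /H wZ.
by rewrite has_unique_occurrence wZ.
Qed.

Lemma weight_indicator (Z : pred V) w :
  weight (fun z => if Z z then S7a else S7one) w = count Z w.
Proof.
rewrite /weight -sum1_count [RHS]big_mkcond /=.
by apply: eq_bigr => z _; case: (Z z).
Qed.

Lemma eq_weight A A' w : {in w, A =1 A'} -> weight A w = weight A' w.
Proof. by move=> AA'; apply: eq_big_seq => z /AA' ->. Qed.

Lemma weight_ge A w z : z \in w -> wt (A z) <= weight A w.
Proof. by move=> zw; rewrite /weight (big_rem z) //= leq_addr. Qed.

Lemma weight_eq0 A w : weight A w = 0 <-> (forall z, z \in w -> A z = S7one).
Proof.
split=> [w0 z /(@weight_ge A)|H]; first by rewrite w0; case: (A z).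
by rewrite /weight big_seq big1 // => z /H ->.
Qed.

Lemma equiweightedC U U' : equiweighted U U' -> equiweighted U' U.
Proof. by move=> H A b /(H A) []. Qed.

(** The test assignment sends content U to 1 and everything else to oo, so
    that a word weighs 0 only if it lies over content U. *)
Lemma equiweighted_content_sub U U' :
  equiweighted U U' -> content U' `<=` content U.
Proof.
move=> H; apply/fsubsetP => z /contentP[w wU' zw].
have /(H _ 0 isT)/(_ w wU')/weight_eq0/(_ z zw) :
    weighs U (fun z => if z \in content U then S7one else S7inf) 0.
  move=> w' w'U; apply/weight_eq0 => y yw'.
  by rewrite ifT //; apply/contentP; exists w'.
by case: ifP.
Qed.

(** If all words of U weigh 1, no variable of U has the value oo and the
    variables with value a form a member of delta U. *)
Lemma content_delta_weighs U U' A b : U != fset0 ->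
  content U = content U' -> delta U = delta U' -> b <= 1 ->
  weighs U A b -> weighs U' A b.
Proof.
move=> U0 cU dU; case: b => [|[|//]] _ UA w wU'.
  apply/weight_eq0 => z zw.
  have /contentP[w' /UA/weight_eq0 H /H //] : z \in content U.
  by rewrite cU; apply/contentP; exists w.
pose Z := [fset z in content U | A z == S7a].
have AE z : z \in content U -> A z = if z \in Z then S7a else S7one.
  move=> zU; rewrite !inE zU /=; case/contentP: zU => w' /UA w'1.
  by move/(@weight_ge A); rewrite w'1; case: (A z).
have AZ w' : {subset w' <= content U} -> weight A w' = count (mem Z) w'.
  by move=> w'U; rewrite -weight_indicator; apply: eq_weight => z /w'U/AE.
have UZ w' : w' \in U -> count (mem Z) w' = 1.
  move=> w'U; rewrite -AZ ?UA // => z zw'.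
  by apply/contentP; exists w'.
rewrite AZ => [|z zw]; last by rewrite cU; apply/contentP; exists w.
suff /deltaP[_ _ ->//] : Z \in delta U'.
rewrite -dU; apply/deltaP; split=> //.
  by apply/fsubsetP => z; rewrite !inE => /andP[].
have /fset0Pn[w' /UZ w'1] := U0.
have /hasP[z _ zZ] : has (mem Z) w' by rewrite has_count w'1.
by apply/fset0Pn; exists z.
Qed.

Lemma equiweighted_delta_sub U U' :
  equiweighted U U' -> delta U `<=` delta U'.
Proof.
move=> H; apply/fsubsetP => Z /deltaP[ZU Z0 UZ]; apply/deltaP; split=> //.
  exact/(fsubset_trans ZU)/equiweighted_content_sub/equiweightedC.
move=> w wU'; rewrite -weight_indicator.
by apply: (H _ 1 isT).1 w wU' => w' w'U; rewrite weight_indicator UZ.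
Qed.

Lemma equiweightedP U U' : U != fset0 -> U' != fset0 ->
  equiweighted U U' <-> content U = content U' /\ delta U = delta U'.
Proof.
move=> U0 U'0; split=> [H|[cU dU] A b b1]; last first.
  by split; apply: content_delta_weighs.
have H' := equiweightedC H.
by split; apply/eqP; rewrite eqEfsubset ?equiweighted_content_sub
  ?equiweighted_delta_sub.
Qed.

End Weight.

(** * Coordinate expansions as walks *)

Section Walks.
Variables (X : choiceType) (n : nat).
Implicit Types (A : X * ('I_n * 'I_n) -> S7) (w : seq X) (s : seq 'I_n).
Implicit Types (p q r i : 'I_n) (u : {fset seq X}).

(** The walk starting at r whose t-th letter leads to the t-th entry of s. The
    endpoint belongs to s, unlike in [coord_word]; this makes walks compatible
    with concatenation and with maps between index sets. *)
Definition walk w r s : seq (X * ('I_n * 'I_n)) := zip w (zip (r :: s) s).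
Arguments walk : simpl never.

Lemma weight_walk_cons A x w r i s :
  weight A (walk (x :: w) r (i :: s)) =
  wt (A (x, (r, i))) + weight A (walk w i s).
Proof. by rewrite /weight /walk /= big_cons. Qed.

Lemma weight_walk_nil A r s : weight A (walk [::] r s) = 0.
Proof. by rewrite /walk; case: s => [|? ?]; rewrite /weight big_nil. Qed.

Lemma weight_walk_cat A w1 w2 r s1 s2 : size w1 = size s1 ->
  weight A (walk (w1 ++ w2) r (s1 ++ s2)) =
  weight A (walk w1 r s1) + weight A (walk w2 (last r s1) s2).
Proof.
elim: w1 r s1 => [|x w1 IH] r [|i s1] //=; first by rewrite weight_walk_nil.
by move=> [] /IH w1s1; rewrite !weight_walk_cons w1s1 addnA.
Qed.

Lemma coord_word_walk p q x w s :
  coord_word p q (x :: w) s = walk (x :: w) p (rcons s q).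
Proof.
rewrite /coord_word /walk; congr zip.
by elim: s {x w} p => [|i s IH] p //=; rewrite IH.
Qed.

Lemma expandP p q u t : [::] \notin u ->
  reflect (exists w s, [/\ w \in u, size s = size w, last p s = q
                         & t = walk w p s])
          (t \in expand p q u).
Proof.
move=> u_nnil; rewrite /expand; apply: (iffP (bigfcupP _ _ _ _)).
  case=> -[|x w] /andP[wu _]; first by rewrite wu in u_nnil.
  case/imfsetP => s _ ->; exists (x :: w), (rcons s q).
  by rewrite size_rcons size_tuple last_rcons coord_word_walk.
case=> -[|x w] [s] [wu]; first by rewrite wu in u_nnil.
case/lastP: s => [|s q'] //; rewrite size_rcons last_rcons => -[sw] -> ->.
exists (x :: w); first by rewrite wu.
have /eqP sz : size s = (size (x :: w)).-1 by [].
by apply/imfsetP; exists (Tuple sz); rewrite //= coord_word_walk.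
Qed.

Lemma weighs_expand p q u A b : [::] \notin u ->
  weighs (expand p q u) A b <->
  (forall w s, w \in u -> size s = size w -> last p s = q ->
     weight A (walk w p s) = b).
Proof.
move=> u_nnil; split=> [H w s wu sw sq|H t /(expandP _ _ _ u_nnil)].
  by apply: H; apply/expandP => //; exists w, s.
by case=> w [s] [wu sw sq ->]; apply: H.
Qed.

Lemma expand_neq0 p q u : [::] \notin u -> u != fset0 -> expand p q u != fset0.
Proof.
move=> u_nnil /fset0Pn[[|x w] wu]; first by rewrite wu in u_nnil.
apply/fset0Pn; exists (walk (x :: w) p (rcons (nseq (size w) p) q)).
apply/expandP => //; exists (x :: w), (rcons (nseq (size w) p) q).
by rewrite size_rcons size_nseq last_rcons.
Qed.

End Walks.

(** * Change of index set *)

Definition relabel (X : Type) m n (g : 'I_m -> 'I_n)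
    (z : X * ('I_m * 'I_m)) : X * ('I_n * 'I_n) :=
  (z.1, (g z.2.1, g z.2.2)).

Lemma weight_walk_relabel (X : choiceType) m n (g : 'I_m -> 'I_n)
    (A : X * ('I_n * 'I_n) -> S7) w r s :
  weight (A \o relabel g) (walk w r s) = weight A (walk w (g r) (map g s)).
Proof.
elim: w r s => [|x w IH] r [|i s]; rewrite ?weight_walk_nil //.
  by rewrite /weight /walk /= !big_nil.
by rewrite /= !weight_walk_cons IH.
Qed.

(** Only one direction holds when g is not surjective: the walks in [m] are
    sent to those walks in [n] that stay in the image of g. *)
Lemma weighs_relabel (X : choiceType) m n (g : 'I_m -> 'I_n)
    (A : X * ('I_n * 'I_n) -> S7) (u : {fset seq X}) p q b : [::] \notin u ->
  weighs (expand (g p) (g q) u) A b ->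
  weighs (expand p q u) (A \o relabel g) b.
Proof.
move=> u_nnil /(weighs_expand _ _ _ _ u_nnil) H.
apply/weighs_expand => // w s wu sw sq.
by rewrite weight_walk_relabel H ?size_map // last_map sq.
Qed.

Lemma weighs_retract (X : choiceType) m n (f : 'I_n -> 'I_m)
    (g : 'I_m -> 'I_n) (u v : {fset seq X}) p q A b :
  cancel g f -> [::] \notin u -> [::] \notin v ->
  equiweighted (expand (g p) (g q) u) (expand (g p) (g q) v) -> b <= 1 ->
  weighs (expand p q u) A b -> weighs (expand p q v) A b.
Proof.
move=> gK u0 v0 H b1; rewrite -{1}(gK p) -{1}(gK q).
move/(weighs_relabel u0)/(H _ _ b1)/(weighs_relabel v0) => vA w /vA <-.
by apply: eq_weight => -[x [r s]] _; rewrite /= /relabel /= !gK.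
Qed.

Lemma equiweighted_retract (X : choiceType) m n (f : 'I_n -> 'I_m)
    (g : 'I_m -> 'I_n) (u v : {fset seq X}) p q :
  cancel g f -> [::] \notin u -> [::] \notin v ->
  equiweighted (expand (g p) (g q) u) (expand (g p) (g q) v) ->
  equiweighted (expand p q u) (expand p q v).
Proof.
move=> gK u0 v0 H A b b1; split; apply: (weighs_retract gK) => //.
exact: equiweightedC.
Qed.

(** * Interior letters *)

Definition base_path n (p q : 'I_n) m := rcons (nseq m.-1 p) q.

Definition interior (X : choiceType) (u : {fset seq X}) (x : X) :=
  exists w1 w2, [/\ w1 != [::], w2 != [::] & w1 ++ x :: w2 \in u].

Lemma weight_walk_gt0 (X : choiceType) n (A : X * ('I_n * 'I_n) -> S7) w p s :
    size s = size w -> 0 < weight A (walk w p s) ->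
  exists w1 y w2 s1 i s2,
    [/\ w = w1 ++ y :: w2, s = s1 ++ i :: s2, size w1 = size s1
      & A (y, (last p s1, i)) != S7one].
Proof.
elim: w p s => [|y w IH] p [|i s] //; rewrite ?weight_walk_nil //= => -[sw].
case Ay: (A (y, (p, i)) == S7one); last first.
  by exists [::], y, w, [::], i, s; rewrite /= Ay.
rewrite weight_walk_cons (eqP Ay) add0n.
case/(IH _ _ sw) => w1 [y'] [w2] [s1] [j] [s2] [-> -> e H].
by exists (y :: w1), y', w2, (i :: s1), j, s2; rewrite /= e.
Qed.

(** A step k -> k of a walk from p to q, with k different from both, can be
    neither the first nor the last one, so an occurrence of the coordinate
    x_kk witnesses that x is interior. *)
Lemma interior_weighs (X : choiceType) n (u : {fset seq X}) x (p q k : 'I_n) :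
  [::] \notin u -> k != p -> k != q ->
  interior u x <->
  ~ weighs (expand p q u)
      (fun z => if z == (x, (k, k)) then S7a else S7one) 0.
Proof.
set A := fun z => _; move=> u_nnil kp kq; split.
  case=> w1 [w2] [w1n w2n wu] /(weighs_expand _ _ _ _ u_nnil).
  move/(_ _ (base_path p k (size w1) ++ k :: base_path k q (size w2)) wu).
  case: w1 w1n wu => // y1 w1 _; case: w2 w2n => // y2 w2 _ _.
  rewrite /base_path /= !size_cat /= !size_rcons /= !size_nseq.
  rewrite last_cat /= last_rcons addSn addnS => /(_ erefl erefl).
  rewrite -[_ :: w1 ++ _]/((y1 :: w1) ++ _).
  rewrite weight_walk_cat ?size_rcons ?size_nseq //.
  by rewrite weight_walk_cons last_rcons {2}/A eqxx addnA addn1.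
move=> H; have /allPn[t tU] : ~~ all (fun t => weight A t == 0) (expand p q u).
  by apply/allP => H'; apply: H => t /H'/eqP.
have /(expandP _ _ _ u_nnil)[w [s [wu sw sq ->]]] := tU.
rewrite -lt0n => /(weight_walk_gt0 sw)[w1 [y [w2 [s1 [i [s2 [we se sz]]]]]]].
rewrite /A; case: ifP => [/eqP[yx s1k ik] _|_]; last by rewrite eqxx.
exists w1, w2; rewrite -{}yx -we; split=> //.
  case: w1 s1 sz s1k {we se} => // -[] //= _ pk.
  by rewrite pk eqxx in kp.
case: w2 we => // we; move: sw sq; rewrite we se !size_cat sz /= => /eqP.
rewrite eqn_add2l eqSS; case: s2 {se} => // _.
by rewrite last_cat /= ik => kq'; rewrite kq' eqxx in kq.
Qed.

(** At an interior occurrence of x, the parts of the walk before r and after s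
    can be chosen independently: A_x(r,s) = b - c(r) - d(s) for suitable
    functions c and d, and such a matrix satisfies the exchange law. *)
Lemma interior_modular (X : choiceType) n (u : {fset seq X})
    (A : X * ('I_n * 'I_n) -> S7) p q b x :
  [::] \notin u -> weighs (expand p q u) A b -> interior u x ->
  forall r s, wt (A (x, (r, s))) + wt (A (x, (p, p))) =
              wt (A (x, (r, p))) + wt (A (x, (p, s))).
Proof.
move=> u_nnil /(weighs_expand _ _ _ _ u_nnil) H [w1 [w2 [w1n w2n wu]]] r s.
pose c r' := weight A (walk w1 p (base_path p r' (size w1))).
pose d s' := weight A (walk w2 s' (base_path s' q (size w2))).
have E r' s' : c r' + (wt (A (x, (r', s'))) + d s') = b.
  have := H _ (base_path p r' (size w1) ++ s' :: base_path s' q (size w2)) wu.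
  rewrite /c /d; case: w1 w2 w1n w2n {wu c d} => [//|y1 w1] [//|y2 w2] _ _.
  rewrite weight_walk_cat ?size_rcons ?size_nseq // last_rcons weight_walk_cons.
  rewrite !size_cat /= !size_rcons !size_nseq last_cat /= last_rcons.
  exact.
by move: (E r s) (E r p) (E p s) (E p p); lia.
Qed.

(** * From three indices to n *)

(** By the exchange law, the weight of a walk i_1, ..., i_m is a constant plus
    a sum of functions of the single vertices i_t. It is therefore constant as
    soon as changing one vertex of the base walk p, ..., p, q does not change
    the weight. *)
Lemma weight_walk_base (X : choiceType) n (A : X * ('I_n * 'I_n) -> S7)
    (w : seq X) (p q : 'I_n) b :
  (forall w1 y w2, w1 != [::] -> w2 != [::] -> w = w1 ++ y :: w2 ->
     forall r s, wt (A (y, (r, s))) + wt (A (y, (p, p))) =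
                 wt (A (y, (r, p))) + wt (A (y, (p, s)))) ->
  w != [::] ->
  weight A (walk w p (base_path p q (size w))) = b ->
  (forall w1 x y w2 k, w = w1 ++ x :: y :: w2 ->
     weight A (walk w p (nseq (size w1) p ++ k :: base_path p q (size w2).+1))
     = b) ->
  forall s, size s = size w -> last p s = q -> weight A (walk w p s) = b.
Proof.
move=> Amod w0 <- Adev.
have dev w1 x y w2 k : w = w1 ++ x :: y :: w2 ->
    wt (A (x, (p, k))) +
      weight A (walk (y :: w2) k (base_path p q (size w2).+1)) =
    wt (A (x, (p, p))) +
      weight A (walk (y :: w2) p (base_path p q (size w2).+1)).
  move=> we; have := Adev _ _ _ _ k we; rewrite -(Adev _ _ _ _ p we) we.
  rewrite !weight_walk_cat ?size_nseq // !weight_walk_cons.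
  have -> : last p (nseq (size w1) p) = p by elim: (size w1) => //=.
  by move/addnI.
(* The suffix c of w is walked from p, as if the vertices before it had been
   replaced by p already. *)
suff claim c w1 s : w = w1 ++ c -> c != [::] -> size s = size c ->
    last p s = q ->
    weight A (walk c p s) = weight A (walk c p (base_path p q (size c))).
  by move=> s; apply: (claim _ [::]).
elim: c w1 s => // x c IH w1 [//|i s] we _ [].
case: c we IH => [|y c] we IH; first by case: s => //= _ ->.
case: s => [//|j s] [sc] /= lq.
have := dev _ _ _ _ i we; rewrite /base_path /= !weight_walk_cons.
case: c we sc IH => [|z c] we sc IH.
  by case: s sc lq => //= _ ->; rewrite !weight_walk_cons.
have we' : w = (rcons w1 x) ++ y :: z :: c by rewrite cat_rcons.
have := IH _ (j :: s) we' isT _ lq; rewrite /= sc => /(_ erefl).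
have := Amod _ _ _ _ _ we' i j; rewrite -size_eq0 size_rcons => /(_ isT isT).
rewrite /base_path /= !weight_walk_cons; lia.
Qed.

Lemma weighs_of_equiweighted3 (X : choiceType) n (u v : {fset seq X})
    (A : X * ('I_n * 'I_n) -> S7) p q b :
  [::] \notin u -> [::] \notin v ->
  equiweighted (expand idx1 idx2 u) (expand idx1 idx2 v) -> b <= 1 ->
  weighs (expand p q u) A b -> weighs (expand p q v) A b.
Proof.
move=> u0 v0 uv b1 uA.
(* [g k] maps the three indices to p, q, k in this order. *)
pose g k (i : 'I_3) := nth k [:: p; q] i.
have gvA k : weighs (expand idx1 idx2 v) (A \o relabel (g k)) b.
  by apply/(uv _ _ b1)/weighs_relabel.
pose k3 : 'I_3 := ord_max.
have uv_int x : interior v x -> interior u x.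
  move=> vx; apply/(@interior_weighs _ _ _ _ idx1 idx2 k3) => //.
  by move/(uv _ 0 isT); apply/interior_weighs.
have lift k w (s : seq 'I_3) : w \in v -> size s = size w ->
    last idx1 s = idx2 -> weight A (walk w p (map (g k) s)) = b.
  move=> wv sw sq; rewrite -[p]/(g k idx1) -weight_walk_relabel.
  by move/(weighs_expand _ _ _ _ v0): (gvA k); apply.
apply/weighs_expand => // w s wv.
apply: weight_walk_base.
- move=> w1 y w2 w1n w2n we; apply: (interior_modular u0 uA).
  by apply: uv_int; exists w1, w2; rewrite -we.
- by apply: contraNneq v0 => <-.
- have := lift p w (base_path idx1 idx2 (size w)) wv.
  rewrite /base_path map_rcons map_nseq; apply; last by rewrite last_rcons.
  by rewrite size_rcons size_nseq; case: w wv v0 => [->|].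
move=> w1 x y w2 k we.
pose t := nseq (size w1) idx1 ++ k3 :: base_path idx1 idx2 (size w2).+1.
have := lift k w t wv.
rewrite /t /base_path map_cat /= map_rcons !map_nseq; apply.
  by rewrite we !size_cat /= size_rcons !size_nseq.
by rewrite last_cat /= last_rcons.
Qed.

(** * Evaluation in the matrix semiring *)

Section EvalMatrix.
Variables (X : choiceType) (n : nat) (phi : X -> aimatrix S7 n).
Implicit Types (p q : 'I_n) (w : seq X) (M : 'M[S7]_n).

Definition entries (z : X * ('I_n * 'I_n)) : S7 :=
  (phi z.1 : 'M_n) z.2.1 z.2.2.

Lemma wt_aimx_mul (M N : 'M[S7]_n) p q b : b <= 1 ->
  wt ((aimx_mul M N : 'M_n) p q) = b <->
  (forall k, wt (M p k) + wt (N k q) = b).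
Proof.
move=> b1; have /esym E := Some_aimx_mul M N p q.
rewrite (wt_osum b1 E); split=> [H k|H k z _ [<-]]; apply/(wt_mul _ _ b1) => //.
by apply: H; rewrite ?mem_index_enum.
Qed.

(** The initial matrix M contributes the first step of a path from p. It has to
    be arbitrary for the induction on w, as the product associates to the
    left. *)
Lemma wt_foldl_mul M w p q b : b <= 1 ->
  wt ((foldl (@monoid.mul (aimatrix S7 n)) M (map phi w) : 'M_n) p q) = b <->
  (forall k s, size s = size w -> last k s = q ->
     wt (M p k) + weight entries (walk w k s) = b).
Proof.
move=> b1; elim: w M => [|x w IH] M /=.
  split=> [Mb k [|//] _ /= -> |/(_ q [::] erefl erefl)].
    by rewrite weight_walk_nil addn0.
  by rewrite weight_walk_nil addn0.
rewrite IH; split=> H.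
  move=> k [|j s] //= [sw] lq; rewrite weight_walk_cons addnA.
  have := H j s sw lq; set c := weight _ _ => Hc.
  have cb : wt ((aimx_mul M (phi x) : 'M_n) p j) = b - c by rewrite -Hc addnK.
  have b1' : b - c <= 1 by lia.
  have := (wt_aimx_mul _ _ _ _ b1').1 cb k; rewrite /entries /=; lia.
move=> k s sw lq; set c := weight _ _.
have E j : wt (M p j) + wt ((phi x : 'M_n) j k) + c = b.
  by have := H j (k :: s); rewrite /= sw weight_walk_cons addnA; apply.
have b1' : b - c <= 1 by lia.
have /= -> := (wt_aimx_mul M (phi x) p k b1').2; first by have := E k; lia.
by move=> j; rewrite -(E j) addnK.
Qed.

Lemma wt_eval (u : term X) p q b : b <= 1 ->
  wt ((eval phi u : 'M_n) p q) = b <-> weighs (expand p q u) entries b.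
Proof.
move=> b1; pose ent := omap (fun M : aimatrix S7 n => (M : 'M_n) p q).
have entD : {morph ent : x y / oadd x y}.
  by case=> [M|] [N|] //=; rewrite /ent /= mxE.
have : Some ((eval phi u : 'M_n) p q) = ent (Some (eval phi u)) by [].
rewrite /eval Some_oextract (big_morph ent entD erefl) => /esym/(wt_osum b1) ->.
rewrite (weighs_expand _ _ _ _ (words_nonnil u)).
split=> [H w s wu sw lq|H w z].
  case: w wu sw => [|x w] wu; first by have := words_nonnil u; rewrite wu.
  case: s lq => [//|i s] /= lq [sw].
  have /(wt_foldl_mul _ _ _ _ b1)/(_ i s sw lq) := H _ _ wu erefl.
  by rewrite weight_walk_cons.
case: w => [//|x w] wu [<-]; apply/(wt_foldl_mul _ _ _ _ b1) => k s sw lq.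
have := H _ (k :: s) wu; rewrite /= sw weight_walk_cons; exact.
Qed.

End EvalMatrix.

Lemma satisfies_equiweighted (X : choiceType) n (u v : term X) :
  satisfies (aimatrix S7 n) u v <->
  forall p q : 'I_n, equiweighted (expand p q u) (expand p q v).
Proof.
split=> [H p q A b b1|H phi]; last first.
  apply/matrixP => p q; apply: wt_inj_le1 => b b1.
  by rewrite !wt_eval //; apply: H.
pose phi x : aimatrix S7 n := (\matrix_(r, s) A (x, (r, s)))%R.
have phiA U : weighs U A b <-> weighs U (entries phi) b.
  by split=> UA w /UA <-; apply: eq_weight => -[x [r s]] _;
    rewrite /entries mxE.
by rewrite !phiA -!wt_eval // H.
Qed.

(** * The identities of the matrix semirings *)

Theorem theorem5p3 (n : nat) (X : choiceType) (u v : term X) (hn : 3 <= n) :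
  satisfies (aimatrix S7 n) u v <->
  [/\ content (expand idx1 idx1 u) = content (expand idx1 idx1 v),
      delta (expand idx1 idx1 u) = delta (expand idx1 idx1 v),
      content (expand idx1 idx2 u) = content (expand idx1 idx2 v)
    & delta (expand idx1 idx2 u) = delta (expand idx1 idx2 v)].
Proof.
have [u0 v0] := (words_nonnil u, words_nonnil v).
have [uN vN] := (words_neq0 u, words_neq0 v).
rewrite satisfies_equiweighted; split=> [uv|[_ _ c12 d12] p q].
  pose f (i : 'I_n) : 'I_3 := inord i.
  have fK : cancel (widen_ord hn) f by move=> i; apply: inord_val.
  have uv3 (p q : 'I_3) :
      content (expand p q u) = content (expand p q v) /\
      delta (expand p q u) = delta (expand p q v).
    by apply/equiweightedP; rewrite ?expand_neq0 //;
      apply: equiweighted_retract fK _ _ _.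
  by have [[? ?] [? ?]] := (uv3 idx1 idx1, uv3 idx1 idx2).
have uv12 : equiweighted (expand idx1 idx2 u) (expand idx1 idx2 v).
  by apply/equiweightedP; rewrite ?expand_neq0.
move=> A b b1; split; apply: weighs_of_equiweighted3 => //.
exact: equiweightedC.
Qed.
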